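(* Let $1\le t\le f$ and $n\ge 3f+2t-1$. The generalized fast Byzantine consensus algorithm described in the context, run by $n$ processes of which at most $f$ are Byzantine, satisfies the consistency property of consensus: no two correct processes decide on different values.
   Context: Model. There are $n$ processes $\Pi=\{p_1,\dots,p_n\}$, at most $f$ of which are Byzantine (behave arbitrarily); the others are correct. Channels are reliable, authenticated and point-to-point; digital signatures $\mathrm{sign}_q(\cdot)$ of correct processes cannot be forged; the system is partially synchronous. Each process $p$ has an input value $x^{\mathrm{in}}_p$. Algorithm. Views: each process has a current view number, initially $1$, managed by a background view synchronization protocol; a correct process never decreases its view number and only sends messages associated with its current view. The leader of view $v$ is $\mathrm{leader}(v)=p_{(v \bmod n)+1}$. Proposing in view $v$: the leader $p$, having a value $\hat x$ and a progress certificate $\hat\sigma$ for $\hat x$ in view $v$, sends $\mathrm{propose}(\hat x,v,\hat\sigma,\hat\tau)$ to all, where $\hat\tau=\mathrm{sign}_p((\mathrm{propose},\hat x,v))$; a correct leader issues at most one proposal in its view. In view $1$ the leader uses its own input and $\hat\sigma=\bot$ (any value with certificate $\bot$ is considered certified in view 1). When a correct process $q$ receives a proposal for the first time in its current view $v$ from $\mathrm{leader}(v)$, and $\hat\sigma,\hat\tau$ are valid, it sets its local variable $\mathit{vote}_q$ to $(\hat x,v,\hat\sigma,\hat\tau)$ and then sends to every process $\mathrm{ack}(\hat x,v)$ and, in a separate message, the signature $\mathrm{sign}_q((\mathrm{ack},\hat x,v))$. Deciding. Fast path: a process decides $x$ in view $v$ upon receiving $\mathrm{ack}(x,v)$ from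 $n-t$ processes. Slow path: a (valid) commit certificate for $x$ in view $v$ is a set of $\lceil\frac{n+f+1}{2}\rceil$ signatures by distinct processes on $(\mathrm{ack},x,v)$. Upon collecting one, a correct process sends $\mathrm{Commit}(x,v,cc)$ to all, where $cc$ is the certificate. A process decides $x$ in view $v$ upon receiving valid $\mathrm{Commit}$ messages for $x$ in view $v$ from $\lceil\frac{n+f+1}{2}\rceil$ processes. Votes: initially $\mathit{vote}=\mathit{nil}$. A vote is valid if it is $\mathit{nil}$ or it is $(x,u,\sigma,\tau)$ with $\sigma$ a valid progress certificate for $x$ in view $u$ and $\tau$ a valid signature of $\mathrm{leader}(u)$ on $(\mathrm{propose},x,u)$; the latter is a vote for $x$ in view $u$. When a correct process changes its current view to $v$, it sends its signed vote to $\mathrm{leader}(v)$, adding the latest commit certificate it has collected (if any). Selection (by the leader of view $v>1$): wait for valid votes from $n-f$ processes. If all are $\mathit{nil}$, select the leader's own input. Otherwise let $w$ be the highest view number in a received valid vote. If only one value $x$ has a received valid vote in view $w$, select $x$. Otherwise $q=\mathrm{leader}(w)$ has provably equivocated; wait until valid votes from $n-f$ processes other than $q$ are received (restart the selection if $w$ is no longer the highest view), and let $\mathit{votes}'$ be these $n-f$ votes. (1) If there is a commit certificate for a value $x$ in view $w$ in $\mathit{votes}'$, select $x$. (2) Otherwise, if $\mathit{votes}'$ contains $f+t$ valid votes for a value $x$ in view $w$, select $x$. (3) Otherwise any value may be selected and the leader selects its own input. Progress certificate (view $v>1$): the leader sends the collected votes and the selected value $\hat x$ to at least $2f+1$ processes.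 A correct process signs $(\mathrm{CertAck},\hat x,v)$ only after verifying, from the given signed votes, that $\hat x$ is a correct outcome of the selection algorithm (any value being accepted in the cases where the leader is to select its own input). A valid progress certificate for $\hat x$ in view $v>1$ is a set of $f+1$ signatures by distinct processes on $(\mathrm{CertAck},\hat x,v)$. *)

(* Defs.v *)
From mathcomp Require Import all_boot.

Set Implicit Arguments.
Unset Strict Implicit.
Unset Printing Implicit Defensive.

(* Signatures are symbolic: a signature is identified with the pair of its
   signer and the signed content, and holding one means that it verifies.
   Unforgeability is the side condition of [byzantine_send] below. A set of
   signatures by distinct processes on a content that is known from the context
   is represented by the set of its signers.

   The processes are the elements of 'I_n: p_{i+1} in the 1-based numbering of
   the algorithm is the ordinal of value i, so that leader(v) = p_{(v mod n)+1}
   is the ordinal of value v mod n. *)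
Definition leads n (p : 'I_n) (v : nat) : bool := (p : nat) == v %% n.

(* None is the empty certificate, valid in view 1 only; Some Q consists of the
   signatures by the members of Q on (CertAck, x, v). *)
Definition progress_cert n := option {set 'I_n}.

(* [Vote x u sigma tau]: tau is the signer of the leader's signature on
   (propose, x, u). *)
Inductive vote (Value : Type) n :=
| NoVote
| Vote (x : Value) (u : nat) (sigma : progress_cert n) (tau : 'I_n).
Arguments NoVote {Value n}.

(* The signatures by the members of cc_signers on (ack, cc_value, cc_view). *)
Record commit_cert (Value : Type) n := CommitCert {
  cc_value : Value;
  cc_view : nat;
  cc_signers : {set 'I_n}
}.

(* A vote is signed together with the attached commit certificate and with the
   view for which it is sent: a leader can neither strip the certificate from a
   vote nor reuse a vote sent for another view. *)
Inductive content (Value : Type) n :=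
| SPropose (x : Value) (v : nat)
| SAck (x : Value) (v : nat)
| SCertAck (x : Value) (v : nat)
| SVote (vt : vote Value n) (occ : option (commit_cert Value n)) (v : nat).
Arguments SPropose {Value n}.
Arguments SAck {Value n}.
Arguments SCertAck {Value n}.

Definition signature (Value : Type) n := ('I_n * content Value n)%type.

(* The signed votes collected for a view, at most one per process. *)
Definition ballot (Value : Type) n :=
  'I_n -> option (vote Value n * option (commit_cert Value n)).

(* The 'I_n arguments (tau and signer) are the signers of the signatures
   carried by the message, on the contents given by [signed_in]. *)
Inductive payload (Value : Type) n :=
| Propose (x : Value) (v : nat) (sigma : progress_cert n) (tau : 'I_n)
| Ack (x : Value) (v : nat)
| AckSig (x : Value) (v : nat) (signer : 'I_n)
| Commit (x : Value) (v : nat) (cc : commit_cert Value n)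
| VoteMsg (signer : 'I_n) (vt : vote Value n)
    (occ : option (commit_cert Value n)) (v : nat)
| CertReq (x : Value) (v : nat) (vs : ballot Value n)
| CertAck (x : Value) (v : nat) (signer : 'I_n).
Arguments Propose {Value n}.
Arguments Ack {Value n}.
Arguments AckSig {Value n}.
Arguments CertReq {Value n}.
Arguments CertAck {Value n}.

Section Model.
Context {Value : Type} {n : nat}.
Implicit Types (p q r tau : 'I_n) (x y : Value) (u v w : nat).
Implicit Types (sg : signature Value n) (sigma : progress_cert n).
Implicit Types (cc : commit_cert Value n) (vt : vote Value n).
Implicit Types (vs : ballot Value n) (m : payload Value n).

Definition signed_in_vote vt sg : Prop :=
  match vt with
  | NoVote => False
  | Vote x u sigma tau =>
      sg = (tau, SPropose x u) \/
      match sigma with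
      | None => False
      | Some Q => exists2 q, q \in Q & sg = (q, SCertAck x u)
      end
  end.

Definition signed_in_cc cc sg : Prop :=
  exists2 q, q \in cc_signers cc & sg = (q, SAck (cc_value cc) (cc_view cc)).

Definition signed_in_signed_vote q vt (occ : option (commit_cert Value n)) v sg
    : Prop :=
  [\/ sg = (q, SVote vt occ v),
      signed_in_vote vt sg
    | exists2 cc, occ = Some cc & signed_in_cc cc sg].

Definition signed_in m sg : Prop :=
  match m with
  | Propose x v sigma tau => signed_in_vote (Vote x v sigma tau) sg
  | Ack _ _ => False
  | AckSig x v q => sg = (q, SAck x v)
  | Commit _ _ cc => signed_in_cc cc sg
  | VoteMsg q vt occ v => signed_in_signed_vote q vt occ v sg
  | CertReq _ v vs =>
      exists q vt occ,
        vs q = Some (vt, occ) /\ signed_in_signed_vote q vt occ v sg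
  | CertAck x v q => sg = (q, SCertAck x v)
  end.

Section Validity.
Variables f t : nat.

(* The ceiling of (n + f + 1) / 2. *)
Definition quorum : nat := uphalf (n + f + 1).

Definition valid_progress_cert v sigma : Prop :=
  match sigma with
  | None => v = 1
  | Some Q => 1 < v /\ #|Q| = f.+1
  end.

Definition valid_vote vt : Prop :=
  match vt with
  | NoVote => True
  | Vote x u sigma tau => valid_progress_cert u sigma /\ leads tau u
  end.

Definition valid_commit_cert cc x v : Prop :=
  [/\ cc_value cc = x, cc_view cc = v & #|cc_signers cc| = quorum].

Definition voted_for vs q x w : Prop :=
  exists sigma tau occ, vs q = Some (Vote x w sigma tau, occ).

Definition has_commit_cert vs q x w : Prop :=
  exists vt cc, vs q = Some (vt, Some cc) /\ valid_commit_cert cc x w.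

Definition voters vs : {set 'I_n} := [set q | isSome (vs q)].

Definition enough_valid_votes vs : Prop :=
  n - f <= #|voters vs| /\
  forall q vt occ, vs q = Some (vt, occ) -> valid_vote vt.

Definition highest_view vs w : Prop :=
  (exists q x, voted_for vs q x w) /\
  (forall q x u, voted_for vs q x u -> u <= w).

Definition equivocation vs w : Prop :=
  exists q1 q2 x1 x2,
    [/\ voted_for vs q1 x1 w, voted_for vs q2 x2 w & x1 <> x2].

(* The set votes' of the selection algorithm, given by its voters. *)
Definition votes' vs w (S : {set 'I_n}) : Prop :=
  [/\ S \subset voters vs, #|S| = n - f & forall q, q \in S -> ~~ leads q w].

Definition cc_rule vs w (S : {set 'I_n}) x : Prop :=
  exists2 q, q \in S & has_commit_cert vs q x w.

Definition count_rule vs w (S : {set 'I_n}) x : Prop :=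
  exists T : {set 'I_n},
    [/\ T \subset S, f + t <= #|T| & forall q, q \in T -> voted_for vs q x w].

(* [selects vs own x]: x is an outcome of the selection algorithm on the votes
   vs, where own holds of the values accepted when the leader is to select its
   own input: this input for the leader itself, any value for a verifier. *)
Inductive selects vs (own : Value -> Prop) x : Prop :=
| SelectNoVote of
    enough_valid_votes vs
  & (forall q vt occ, vs q = Some (vt, occ) -> vt = NoVote)
  & own x
| SelectUnique w of
    enough_valid_votes vs & highest_view vs w
  & (forall q y, voted_for vs q y w -> y = x)
| SelectCommitCert w S of
    enough_valid_votes vs & highest_view vs w & equivocation vs w
  & votes' vs w S
  & cc_rule vs w S x
| SelectCount w S of
    enough_valid_votes vs & highest_view vs w & equivocation vs w
  & votes' vs w S
  & (forall y, ~ cc_rule vs w S y) & count_rule vs w S x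
| SelectFree w S of
    enough_valid_votes vs & highest_view vs w & equivocation vs w
  & votes' vs w S
  & (forall y, ~ cc_rule vs w S y) & (forall y, ~ count_rule vs w S y)
  & own x.

End Validity.

(* acked and proposed refer to the current view, as does selected, the value
   for which the process has requested a progress certificate as a leader.
   cert is the latest commit certificate collected. decided contains every
   value on which the process has decided. *)
Record local_state := LocalState {
  view : nat;
  cur_vote : vote Value n;
  cert : option (commit_cert Value n);
  acked : bool;
  proposed : bool;
  selected : option Value;
  inbox : 'I_n -> payload Value n -> Prop;
  decided : Value -> Prop
}.

Definition init_local : local_state :=
  LocalState 1 NoVote None false false None (fun _ _ => False) (fun _ => False).

Definition has_sig (l : local_state) sg : Prop :=
  exists q m, inbox l q m /\ signed_in m sg.

Definition enter_view (l : local_state) v :=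
  LocalState v (cur_vote l) (cert l) false false None (inbox l) (decided l).
Definition set_vote (l : local_state) vt :=
  LocalState (view l) vt (cert l) true (proposed l) (selected l)
    (inbox l) (decided l).
Definition set_cert (l : local_state) cc :=
  LocalState (view l) (cur_vote l) (Some cc) (acked l) (proposed l)
    (selected l) (inbox l) (decided l).
Definition set_proposed (l : local_state) :=
  LocalState (view l) (cur_vote l) (cert l) (acked l) true (selected l)
    (inbox l) (decided l).
Definition set_selected (l : local_state) x :=
  LocalState (view l) (cur_vote l) (cert l) (acked l) (proposed l)
    (Some x) (inbox l) (decided l).
Definition add_inbox (l : local_state) q m :=
  LocalState (view l) (cur_vote l) (cert l) (acked l) (proposed l)
    (selected l) (fun q' m' => inbox l q' m' \/ (q' = q /\ m' = m))
    (decided l).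
Definition add_decided (l : local_state) x :=
  LocalState (view l) (cur_vote l) (cert l) (acked l) (proposed l)
    (selected l) (inbox l) (fun y => decided l y \/ y = x).

(* A set of (destination, message) pairs. *)
Definition output := 'I_n -> payload Value n -> Prop.
Definition no_output : output := fun _ _ => False.
Definition send_all m : output := fun _ m' => m' = m.

(* [correct_step f t p x_in l l' out]: the correct process p with input x_in
   may move from l to l' while sending out. Nothing forces an enabled step to be
   taken, and the view synchronization protocol is arbitrary except that it
   never decreases a view. *)
Inductive correct_step (f t : nat) p (x_in : Value) (l : local_state) :
    local_state -> output -> Prop :=
| ChangeView v of view l < v :
    correct_step f t p x_in l (enter_view l v)
      (fun dst m => leads dst v /\ m = VoteMsg p (cur_vote l) (cert l) v)
| ProposeFirst of view l = 1 & leads p 1 & proposed l = false :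
    correct_step f t p x_in l (set_proposed l)
      (send_all (Propose x_in 1 None p))
| Select vs x (R : {set 'I_n}) of
    1 < view l & leads p (view l) & selected l = None
  & (forall q vt occ, vs q = Some (vt, occ) ->
       inbox l q (VoteMsg q vt occ (view l)))
  & selects f t vs (fun y => y = x_in) x
  & 2 * f + 1 <= #|R| :
    correct_step f t p x_in l (set_selected l x)
      (fun dst m => dst \in R /\ m = CertReq x (view l) vs)
| Certify r x vs of
    1 < view l & leads r (view l) & inbox l r (CertReq x (view l) vs)
  & selects f t vs (fun _ => True) x :
    correct_step f t p x_in l l
      (fun dst m => dst = r /\ m = CertAck x (view l) p)
| ProposeCertified x (S : {set 'I_n}) of
    1 < view l & leads p (view l) & proposed l = false
  & selected l = Some x
  & valid_progress_cert f (view l) (Some S)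
  & (forall q, q \in S -> has_sig l (q, SCertAck x (view l))) :
    correct_step f t p x_in l (set_proposed l)
      (send_all (Propose x (view l) (Some S) p))
| AcceptProposal r x sigma tau of
    leads r (view l) & inbox l r (Propose x (view l) sigma tau)
  & acked l = false
  & valid_vote f (Vote x (view l) sigma tau) :
    correct_step f t p x_in l (set_vote l (Vote x (view l) sigma tau))
      (fun _ m => m = Ack x (view l) \/ m = AckSig x (view l) p)
| CollectCert cc x of
    valid_commit_cert f cc x (view l)
  & (forall sg, signed_in_cc cc sg -> has_sig l sg) :
    correct_step f t p x_in l (set_cert l cc)
      (send_all (Commit x (view l) cc))
(* A certificate for a past view is completed: Commit can no longer be sent, but
   the certificate is kept if it is the latest one, i.e. of the highest view. *)
| CollectPastCert cc x u of
    u < view l & valid_commit_cert f cc x u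
  & (forall cc', cert l = Some cc' -> cc_view cc' < u)
  & (forall sg, signed_in_cc cc sg -> has_sig l sg) :
    correct_step f t p x_in l (set_cert l cc) no_output
| DecideFast x v (S : {set 'I_n}) of
    n - t <= #|S| & (forall q, q \in S -> inbox l q (Ack x v)) :
    correct_step f t p x_in l (add_decided l x) no_output
| DecideSlow x v (S : {set 'I_n}) of
    quorum f <= #|S|
  & (forall q, q \in S ->
       exists2 cc, inbox l q (Commit x v cc) & valid_commit_cert f cc x v) :
    correct_step f t p x_in l (add_decided l x) no_output.

(* [sent src dst m]: src has sent m to dst. Messages are never lost, but may
   be delivered at any later time and in any order, so that the executions of
   a partially synchronous system are included. *)
Record global_state := GlobalState {
  local : 'I_n -> local_state;
  sent : 'I_n -> 'I_n -> payload Value n -> Prop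
}.

Definition init_global : global_state :=
  GlobalState (fun _ => init_local) (fun _ _ _ => False).

Definition update (loc : 'I_n -> local_state) p (l : local_state) :=
  fun q => if q == p then l else loc q.

Definition add_sent (s : global_state) p (out : output) :=
  fun src dst m => sent s src dst m \/ (src = p /\ out dst m).

Definition issued (s : global_state) sg : Prop :=
  exists src dst m, sent s src dst m /\ signed_in m sg.

(* The adversary sees all messages sent so far. Every signature of a correct
   process in a Byzantine message is a copy of one already issued. *)
Inductive step (f t : nat) (Byz : {set 'I_n}) (input : 'I_n -> Value)
    (s : global_state) : global_state -> Prop :=
| deliver src dst m of sent s src dst m :
    step f t Byz input s
      (GlobalState (update (local s) dst (add_inbox (local s dst) src m))
         (sent s))
| correct_move p l out of
    p \notin Byz & correct_step f t p (input p) (local s p) l out :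
    step f t Byz input s
      (GlobalState (update (local s) p l) (add_sent s p out))
| byzantine_send p q m of
    p \in Byz
  & (forall sg, signed_in m sg -> sg.1 \notin Byz -> issued s sg) :
    step f t Byz input s
      (GlobalState (local s)
         (add_sent s p (fun dst m' => dst = q /\ m' = m))).

Inductive reachable (f t : nat) (Byz : {set 'I_n}) (input : 'I_n -> Value) :
    global_state -> Prop :=
| reachable_init : reachable f t Byz input init_global
| reachable_step s s' of
    reachable f t Byz input s & step f t Byz input s s' :
    reachable f t Byz input s'.

End Model.

Arguments local_state : clear implicits.
Arguments global_state : clear implicits.

(* Main.v *)
Require Import Defs.
From mathcomp Require Import all_boot zify.

(* A decision on x in view v, fast or slow, rests on a quorum of acks of x in
   view v, and two quorums share a correct process, which acks once per view:
   decisions in the same view agree. It remains to see that after a decision on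
   x in view v a correct process certifies only x in the views above v. The
   votes collected for such a view include that of a correct acker of x, so
   their highest view is at least v. If it is above v, its votes carry
   certificates, which are for x by induction. If it is v, a vote for x is among
   them, and if several values remain then the leader of v is Byzantine and is
   excluded from votes', where at most f - 1 Byzantine votes remain. After a
   fast decision, f + t correct voters of votes' have then voted for x, and
   fewer than f + t votes are left for other values; after a slow one, some
   correct voter shows a commit certificate, which is for x in view v. *)

Set Implicit Arguments.
Unset Strict Implicit.
Unset Printing Implicit Defensive.

(** * Runs of a single correct process *)

Section LocalRun.
Context {Value : Type} {n : nat} (f t : nat) (p : 'I_n) (x_in : Value).
Implicit Types (l : local_state Value n) (H : payload Value n -> Prop).
Implicit Types (x y : Value) (u v w : nat).

(* The states l of a correct process, with an upper bound H of the set of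
   messages that it has sent. *)
Inductive run : local_state Value n -> (payload Value n -> Prop) -> Prop :=
| run_init : run init_local (fun _ => False)
| run_sub l H H' of run l H & (forall m, H' m -> H m) : run l H'
| run_deliver l H q m of run l H : run (add_inbox l q m) H
| run_step l H l' out of run l H & correct_step f t p x_in l l' out :
    run l' (fun m => H m \/ exists dst, out dst m).

Lemma has_sig_add_inbox l q m sg : has_sig l sg -> has_sig (add_inbox l q m) sg.
Proof. by move=> [r [m' [? ?]]]; exists r, m'; split=> //; left. Qed.

Section Step.
Variables (l l' : local_state Value n) (out : @output Value n).
Hypothesis st : correct_step f t p x_in l l' out.

Lemma step_has_sig sg : has_sig l sg -> has_sig l' sg.
Proof. by case: st. Qed.

Lemma step_view : view l <= view l'.
Proof. by case: st => //= v /ltnW. Qed.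

Lemma step_acked : view l' = view l -> acked l -> acked l'.
Proof. by case: st => //= v; lia. Qed.

Lemma step_proposed : view l' = view l -> proposed l -> proposed l'.
Proof. by case: st => //= v; lia. Qed.

Lemma step_cur_vote :
  cur_vote l' = cur_vote l \/
  exists r x sigma tau,
    [/\ acked l = false, inbox l r (Propose x (view l) sigma tau)
      & l' = set_vote l (Vote x (view l) sigma tau)].
Proof.
case: st => //=; try by left.
by move=> r x sigma tau *; right; exists r, x, sigma, tau.
Qed.

Lemma step_cert cc :
  cert l' = Some cc ->
  cert l = Some cc \/
  [/\ cc_view cc <= view l, #|cc_signers cc| = quorum (n := n) f
    & forall sg, signed_in_cc cc sg -> has_sig l sg].
Proof.
case: st => //=; try by left.
  by move=> ? ? [_ hv ?] ? [<-]; right; rewrite hv.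
by move=> ? ? u /ltnW hu [_ hv ?] _ ? [<-]; right; split=> //; rewrite hv.
Qed.

(** [CollectCert] installs a certificate of the current view, hence the bound on the old one;
    [CollectPastCert] only installs a strictly later one. *)
Lemma step_cert_view cc :
  cert l = Some cc -> cc_view cc <= view l ->
  exists2 cc', cert l' = Some cc' & cc_view cc <= cc_view cc'.
Proof.
case: st => //=; try by move=> *; exists cc.
  by move=> cc' x [_ hv _] _ _ hc; exists cc' => //; rewrite hv.
by move=> cc' x u _ [_ <- _] hlt _ /hlt /ltnW ?; exists cc'.
Qed.

Lemma step_ack dst x v :
  out dst (Ack x v) ->
  exists r sigma tau,
    [/\ acked l = false, v = view l, inbox l r (Propose x v sigma tau),
        valid_vote f (Vote x v sigma tau)
      & l' = set_vote l (Vote x v sigma tau)].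
Proof.
case: st => //=; try (by move=> * ; intuition congruence).
move=> r y sigma tau _ hin ha hval [[-> ->]|//].
by exists r, sigma, tau.
Qed.

Lemma step_propose dst x v sigma tau :
  out dst (Propose x v sigma tau) ->
  [/\ proposed l = false, v = view l & l' = set_proposed l].
Proof.
case: st => //=; try (by move=> * ; intuition congruence).
- by move=> hv _ hp [_ -> _ _]; rewrite hv.
- by move=> y S _ _ hp _ _ _ [_ -> _ _].
Qed.

Lemma step_propose_inj dst dst' x y v sigma tau sigma' tau' :
  out dst (Propose x v sigma tau) -> out dst' (Propose y v sigma' tau') ->
  x = y.
Proof.
by case: st => //=; rewrite /send_all /=; intuition congruence.
Qed.

Lemma step_commit dst x v cc :
  out dst (Commit x v cc) ->
  v = view l /\ exists2 cc', cert l' = Some cc' & cc_view cc' = v.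
Proof.
case: st => //=; try (by move=> * ; intuition congruence).
by move=> cc' y [_ hv _] _ [_ -> _]; split=> //; exists cc'.
Qed.

Lemma step_vote_msg dst q vt occ w :
  out dst (VoteMsg q vt occ w) ->
  [/\ view l < w, vt = cur_vote l, occ = cert l & l' = enter_view l w].
Proof.
case: st => //=; try (by move=> * ; intuition congruence).
by move=> v hv [_ [_ -> -> ->]].
Qed.

End Step.

(** * Invariants of local runs *)

Lemma run_ack l H x v :
  run l H -> H (Ack x v) -> v <= view l /\ (v = view l -> acked l).
Proof.
move=> hr; elim: hr x v => {l H} //=.
- by move=> l H H' _ IH sub x v /sub /IH.
- move=> l H l' out _ IH st x v [/IH [hv ha] | [dst]].
    have := step_view st; split=> [|e]; first lia.
    by apply: (step_acked st); [lia | apply: ha; lia].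
  by case/(step_ack st) => r [sg [tau [_ -> _ _ ->]]].
Qed.

(** The flag [acked] is reset only by a strict increase of the view, so a second step acknowledging
    in the same view is blocked. *)
Lemma run_ack_inj l H x y v : run l H -> H (Ack x v) -> H (Ack y v) -> x = y.
Proof.
move=> hr; elim: hr x y v => {l H} //=.
- by move=> l H H' _ IH sub x y v /sub hx /sub; apply: IH.
- move=> l H l' out hr IH st x y v [hx|[dx hx]] [hy|[dy hy]].
  + exact: IH hx hy.
  + have [r [sg [tau [ha ev _ _ _]]]] := step_ack st hy.
    by have [_ /(_ ev)] := run_ack hr hx; rewrite ha.
  + have [r [sg [tau [ha ev _ _ _]]]] := step_ack st hx.
    by have [_ /(_ ev)] := run_ack hr hy; rewrite ha.
  (* Both acknowledgments leave in one step, and the vote it stores fixes the value. *)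
  + have [? [? [? [_ _ _ _ e]]]] := step_ack st hx.
    have [? [? [? [_ _ _ _]]]] := step_ack st hy.
    by rewrite e => - [].
Qed.

Lemma run_propose l H x v sigma tau :
  run l H -> H (Propose x v sigma tau) ->
  v <= view l /\ (v = view l -> proposed l).
Proof.
move=> hr; elim: hr x v sigma tau => {l H} //=.
- by move=> l H H' _ IH sub x v ? ? /sub /IH.
- move=> l H l' out _ IH st x v ? ? [/IH [hv ha] | [dst]].
    have := step_view st; split=> [|e]; first lia.
    by apply: (step_proposed st); [lia | apply: ha; lia].
  by case/(step_propose st) => _ -> ->.
Qed.

Lemma run_propose_inj l H x y v sigma tau sigma' tau' :
  run l H -> H (Propose x v sigma tau) -> H (Propose y v sigma' tau') -> x = y.
Proof.
move=> hr; elim: hr x y v sigma tau sigma' tau' => {l H} //=.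
- by move=> l H H' _ IH sub x y v ? ? ? ? /sub hx /sub; apply: IH hx.
- move=> l H l' out hr IH st x y v ? ? ? ? [hx|[dx hx]] [hy|[dy hy]].
  + exact: IH hx hy.
  + have [ha ev _] := step_propose st hy.
    by have [_ /(_ ev)] := run_propose hr hx; rewrite ha.
  + have [ha ev _] := step_propose st hx.
    by have [_ /(_ ev)] := run_propose hr hy; rewrite ha.
  + exact: step_propose_inj st _ _ _ _ _ _ _ _ _ hx hy.
Qed.

(* What an earlier acknowledgment of x in view v imposes on a vote. *)
Definition covers (vt : vote Value n) x v : Prop :=
  match vt with
  | NoVote => False
  | Vote y u _ _ => v <= u /\ (u = v -> y = x)
  end.

Lemma run_cur_vote l H x v : run l H -> H (Ack x v) -> covers (cur_vote l) x v.
Proof.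
move=> hr; elim: hr x v => {l H} //=.
- by move=> l H H' _ IH sub x v /sub /IH.
- move=> l H l' out hr IH st x v [hx | [dst]].
    case: (step_cur_vote st) => [-> | [r [y [sg [tau [ha _ ->]]]]]].
      exact: IH.
    have [hv ha'] := run_ack hr hx; split=> // ev.
    by rewrite ha' in ha.
  by case/(step_ack st) => r [sg [tau [_ -> _ _ ->]]].
Qed.

(** Sending a vote for [w] moves the process to view [w], after which it acknowledges nothing below
    [w]. Every acknowledgment below [w] thus precedes the vote and is reflected in it. *)
Lemma run_vote_msg l H q vt occ w :
  run l H -> H (VoteMsg q vt occ w) ->
  w <= view l /\ forall x v, H (Ack x v) -> v < w -> covers vt x v.
Proof.
move=> hr; elim: hr q vt occ w => {l H} //=.
- move=> l H H' _ IH sub q vt occ w /sub /IH [hw hc]; split=> // x v /sub.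
  exact: hc.
- move=> l H l' out hr IH st q vt occ w [/IH [hw hc] | [dst]].
    split; first exact: leq_trans hw (step_view st).
    move=> x v [|[dst /(step_ack st) [? [? [? [_ ev _ _ _]]]]]]; last by lia.
    exact: hc.
  case/(step_vote_msg st) => hw -> _ e; split; first by rewrite e.
  move=> x v [hx _|[d /(step_ack st) [? [? [? [_ _ _ _]]]]]].
    exact: run_cur_vote hr hx.
  by rewrite e => -[]; lia.
Qed.

Lemma run_cert l H cc :
  run l H -> cert l = Some cc ->
  [/\ cc_view cc <= view l, #|cc_signers cc| = quorum (n := n) f
    & forall sg, signed_in_cc cc sg -> has_sig l sg].
Proof.
move=> hr; elim: hr cc => {l H} //=.
- move=> l H q m _ IH cc /IH [? ? hs]; split=> // sg /hs.
  exact: has_sig_add_inbox.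
- move=> l H l' out hr IH st cc hcc.
  have [hv hq hs]: [/\ cc_view cc <= view l,
      #|cc_signers cc| = quorum (n := n) f
    & forall sg, signed_in_cc cc sg -> has_sig l sg].
    by case: (step_cert st hcc) => // /IH.
  split=> // [|sg /hs]; first exact: leq_trans hv (step_view st).
  exact: (step_has_sig st).
Qed.

Lemma run_commit l H x v cc :
  run l H -> H (Commit x v cc) ->
  exists2 cc', cert l = Some cc' & v <= cc_view cc'.
Proof.
move=> hr; elim: hr x v cc => {l H} //=.
- by move=> l H H' _ IH sub x v cc /sub /IH.
- move=> l H l' out hr IH st x v cc [/IH [cc' hcc hv] | [dst]].
    have [hvw _ _] := run_cert hr hcc.
    have [cc2 ? hle] := step_cert_view st hcc hvw.
    by exists cc2 => //; apply: leq_trans hle.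
  by case/(step_commit st) => _ [cc' ? <-]; exists cc'.
Qed.

Lemma run_vote_msg_cert l H q vt cc w :
  run l H -> H (VoteMsg q vt (Some cc) w) ->
  cc_view cc < w /\ #|cc_signers cc| = quorum (n := n) f.
Proof.
move=> hr; elim: hr q vt cc w => {l H} //=.
- by move=> l H H' _ IH sub q vt cc w /sub /IH.
- move=> l H l' out hr IH st q vt cc w [/IH // | [dst]].
  case/(step_vote_msg st) => hw _ /esym/(run_cert hr) [? ? _] _.
  by split=> //; apply: leq_ltn_trans hw.
Qed.

(** A [Commit] is sent while in its own view, so one for [v < w] precedes the vote for [w]. The
    attached certificate may have been replaced since, but only by one whose view is no lower. *)
Lemma run_vote_msg_commit l H q vt occ w x v cc :
  run l H -> H (VoteMsg q vt occ w) -> H (Commit x v cc) -> v < w ->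
  exists2 cc', occ = Some cc' & v <= cc_view cc'.
Proof.
move=> hr; elim: hr q vt occ w x v cc => {l H} //=.
- by move=> l H H' _ IH sub q vt occ w x v cc /sub hm /sub; apply: IH hm.
- move=> l H l' out hr IH st q vt occ w x v cc [hm|[d hm]] [hc|[d' hc]] hvw.
  + exact: IH hm hc hvw.
  + have [ev _] := step_commit st hc.
    by have [] := run_vote_msg hr hm; lia.
  + have [_ _ -> _] := step_vote_msg st hm.
    exact: run_commit hr hc.
  + have [ev _] := step_commit st hc; have [_ _ _ e] := step_vote_msg st hm.
    by case: st hm hc => //= *; intuition congruence.
Qed.

Lemma run_cur_vote_sig l H sg :
  run l H -> signed_in_vote (cur_vote l) sg -> has_sig l sg.
Proof.
move=> hr; elim: hr => {l H} //=.
- by move=> l H q m _ IH /IH; apply: has_sig_add_inbox.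
- move=> l H l' out hr IH st hs; apply: (step_has_sig st).
  case: (step_cur_vote st) hs => [-> //|[r [x [sigma [tau [_ hin ->]]]]]] hs.
  by exists r, (Propose x (view l) sigma tau).
Qed.

Lemma run_ack_sig l H x v :
  run l H -> H (Ack x v) ->
  exists sigma tau, valid_vote f (Vote x v sigma tau) /\
    forall sg, signed_in_vote (Vote x v sigma tau) sg -> has_sig l sg.
Proof.
move=> hr; elim: hr x v => {l H} //=.
- by move=> l H H' _ IH sub x v /sub /IH.
- move=> l H q m _ IH x v /IH [sigma [tau [hv hs]]].
  by exists sigma, tau; split=> // sg /hs; apply: has_sig_add_inbox.
- move=> l H l' out hr IH st x v [/IH [sigma [tau [hv hs]]] | [dst hx]].
    by exists sigma, tau; split=> // sg /hs; apply: (step_has_sig st).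
  have [r [sigma [tau [_ _ hin hv _]]]] := step_ack st hx.
  exists sigma, tau; split=> // sg hs; apply: (step_has_sig st).
  by exists r, (Propose x v sigma tau).
Qed.

Definition decision_in_inbox l x v : Prop :=
  (exists S : {set 'I_n},
     n - t <= #|S| /\ forall q, q \in S -> inbox l q (Ack x v)) \/
  (exists S : {set 'I_n}, quorum (n := n) f <= #|S| /\
     forall q, q \in S ->
       exists2 cc, inbox l q (Commit x v cc) & valid_commit_cert f cc x v).

Lemma run_decided l H x :
  run l H -> decided l x -> exists v, decision_in_inbox l x v.
Proof.
move=> hr; elim: hr x => {l H} //=.
- move=> l H q m _ IH x /IH [v [[S [hS hin]]|[S [hS hin]]]]; exists v.
    by left; exists S; split=> // r /hin; left.
  by right; exists S; split=> // r /hin [cc ? ?]; exists cc => //; left.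
- move=> l H l' out _ IH st x.
  case: st => //=; try (by move=> *; apply: IH).
  + by move=> y v S hS hin [/IH // | ->]; exists v; left; exists S.
  + by move=> y v S hS hin [/IH // | ->]; exists v; right; exists S.
Qed.

(** The message that accounts for a signature of [p]. [SAck] is traced to [Ack] rather than
    [AckSig]: both leave in the same step, so commit certificates and plain acknowledgments are
    counted alike. *)
Definition own (K : payload Value n -> Prop) (c : content Value n) : Prop :=
  match c with
  | SPropose x v => exists sigma, K (Propose x v sigma p)
  | SAck x v => K (Ack x v)
  | SCertAck x v => K (CertAck x v p)
  | SVote vt occ v => K (VoteMsg p vt occ v)
  end.

(** A correct process either relays signatures from its inbox, possibly kept in its vote or
    certificate, or creates its own. *)
Lemma run_step_sig l H l' out dst m sg :
  run l H -> correct_step f t p x_in l l' out -> out dst m -> signed_in m sg ->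
  has_sig l sg \/ sg.1 = p /\ own (fun m' => exists d, out d m') sg.2.
Proof.
move=> hr st; case: st => //=.
- move=> v hv [hd ->] /= [->|hs|[cc hcc hs]].
  + by right; split=> //=; exists dst.
  + by left; apply: run_cur_vote_sig hr hs.
  + by left; have [_ _] := run_cert hr hcc; apply.
- move=> hv _ _ -> /= [->|//]; right; split=> //=.
  by exists None, dst.
- move=> vs x R _ _ _ hin _ _ [_ ->] /= [q [vt [occ [hq hs]]]].
  by left; exists q, (VoteMsg q vt occ (view l)); split=> //; apply: hin.
- move=> r x vs _ _ _ _ [_ ->] /= ->; right; split=> //=.
  by exists r.
- move=> x S _ _ _ _ _ hS -> /= [->|[q hq ->]]; last by left; apply: hS.
  by right; split=> //=; exists (Some S), dst.
- move=> r x sigma tau _ hin _ _ [->|->] //= ->; right; split=> //=.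
  by exists dst; left.
- by move=> cc x _ hs -> /= /hs; left.
Qed.

Lemma step_cert_ack l l' out dst x v q :
  correct_step f t p x_in l l' out -> out dst (CertAck x v q) ->
  exists r vs, [/\ 1 < v, inbox l r (CertReq x v vs)
    & selects f t vs (fun _ => True) x].
Proof.
case=> //=; try (by move=> * ; intuition congruence).
by move=> r y vs hv _ hin hsel [_ [-> -> _]]; exists r, vs.
Qed.

End LocalRun.

(** * Global executions and unforgeability *)

Section Executions.
Context {Value : Type} {n : nat} (f t : nat) (Byz : {set 'I_n}).
Context (input : 'I_n -> Value).
Implicit Types (s : global_state Value n) (p q : 'I_n) (x y : Value).
Implicit Types (u v w : nat) (vs : ballot Value n).

Local Notation reach := (reachable f t Byz input).

Definition log s p m := exists dst, sent s p dst m.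

Definition incl_sent s s' :=
  forall src dst m, sent s src dst m -> sent s' src dst m.

Lemma incl_issued s s' sg : incl_sent s s' -> issued s sg -> issued s' sg.
Proof.
move=> hsub [src [dst [m [hm ?]]]]; exists src, dst, m; split=> //.
exact: hsub.
Qed.

Lemma incl_log s s' p m : incl_sent s s' -> log s p m -> log s' p m.
Proof. by move=> hsub [dst hm]; exists dst; apply: hsub. Qed.

Lemma step_incl s s' : step f t Byz input s s' -> incl_sent s s'.
Proof. by case=> [? ? ? _|? ? ? _ _|? ? ? _ _] src dst m //=; left. Qed.

Lemma log_issued s p m sg : log s p m -> signed_in m sg -> issued s sg.
Proof. by move=> [dst hm] hs; exists p, dst, m. Qed.

Lemma inbox_sent s p q m : reach s -> inbox (local s p) q m -> sent s q p m.
Proof.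
move=> hr; elim: hr p q m => {s} // s s' _ IH [].
- move=> src dst m' hm p q m /=; rewrite /update.
  by case: eqP => [->|_] /=; [case=> [/IH //|[-> ->]]|move/IH].
- move=> p' l out _ st p q m /=; rewrite /update => hin; left; apply: IH.
  by case: eqP hin => [->|//]; case: st.
- by move=> ? ? ? _ _ p q m /= /IH; left.
Qed.

Lemma has_sig_issued s p sg : reach s -> has_sig (local s p) sg -> issued s sg.
Proof.
by move=> hr [q [m [/(inbox_sent hr) hm hs]]]; exists q, p, m.
Qed.

(** Projection of an execution onto one process. [run_sub] absorbs the differences between logs that
    agree only extensionally. *)
Lemma reachable_run s p :
  p \notin Byz -> reach s -> run f t p (input p) (local s p) (log s p).
Proof.
move=> hp; elim=> {s} [|s s' _ IH].
  by apply: run_sub (run_init _ _ _ _) _ => m [].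
case.
- move=> src dst m _; rewrite /= /update; case: eqP => [<-|_].
    exact: run_deliver IH.
  exact: IH.
- move=> p' l out _ st; rewrite /= /update; case: eqP => [e|ne].
    move: st; rewrite -e => st; apply: run_sub (run_step IH st) _ => m.
    by move=> [dst [hm|[_ hm]]]; [left|right]; exists dst.
  by apply: run_sub IH _ => m [dst [hm|[e _]]]; [exists dst|case: ne].
- move=> p' q m hp' _ /=; apply: run_sub IH _ => m'.
  by move=> [dst [hm|[e _]]]; [exists dst|move: hp; rewrite e hp'].
Qed.

Lemma own_sub p (K K' : payload Value n -> Prop) c :
  (forall m, K m -> K' m) -> own p K c -> own p K' c.
Proof.
move=> sub.
by case: c => [x v [sigma h]|x v h|x v h|vt occ v h]; try exists sigma;
  apply: sub.
Qed.

(** When a signature of a correct process first appears, it is neither relayed nor in a Byzantine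
    message, so its signer has just created it. *)
Lemma issued_own s sg :
  reach s -> sg.1 \notin Byz -> issued s sg -> own sg.1 (log s sg.1) sg.2.
Proof.
move=> hr hsg; elim: hr => {s} [|s s' hr IH st]; first by move=> [? [? [? []]]].
have mono : issued s sg -> own sg.1 (log s' sg.1) sg.2.
  move/IH; apply: own_sub => m; exact: incl_log (step_incl st).
move=> [src [dst [m [hm hs]]]].
case: st mono hm => [src' dst' m' _|p l out hp cs|p q m' _ hiss] mono hm.
- by apply: mono; exists src, dst, m.
- case: hm => [hm|[_ hm]]; first by apply: mono; exists src, dst, m.
  case: (run_step_sig (reachable_run hp hr) cs hm hs) => [h|[-> h]].
    by apply: mono; apply: has_sig_issued h.
  by apply: own_sub h => m' [d hd]; exists d; right.
- case: hm => [hm|[_ [_ e]]]; first by apply: mono; exists src, dst, m.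
  by apply: mono; apply: hiss => //; rewrite -e.
Qed.

(** The common consequence of fast decisions, slow decisions and commit certificates. Byzantine
    members of [A] are unconstrained. *)
Definition quorum_acked s x v : Prop :=
  exists A : {set 'I_n}, quorum (n := n) f <= #|A| /\
    forall q, q \in A -> q \notin Byz -> log s q (Ack x v).

Definition fast_decision s x v : Prop :=
  exists A : {set 'I_n}, n - t <= #|A| /\
    forall q, q \in A -> q \notin Byz -> log s q (Ack x v).

Definition slow_decision s x v : Prop :=
  exists A : {set 'I_n}, quorum (n := n) f <= #|A| /\
    forall q, q \in A -> q \notin Byz ->
      exists2 cc, log s q (Commit x v cc) & valid_commit_cert f cc x v.

Definition decision s x v : Prop := fast_decision s x v \/ slow_decision s x v.

(* The signatures that a verifier of the votes vs for view w has seen. *)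
Definition issued_ballot s vs w : Prop :=
  forall q vt occ, vs q = Some (vt, occ) ->
    forall sg, signed_in_signed_vote q vt occ w sg -> issued s sg.

(** The ballot behind a new [CertAck] contains only signatures issued before the step, which lets an
    induction on executions descend. *)
Lemma log_cert_ack_step s s' p x v :
  p \notin Byz -> reach s -> step f t Byz input s s' ->
  log s' p (CertAck x v p) ->
  log s p (CertAck x v p) \/
  exists vs, [/\ 1 < v, issued_ballot s vs v
    & selects f t vs (fun _ => True) x].
Proof.
move=> hp hr; case=> [? ? ? _ h|p' l out _ cs|p' q m hp' _] //=.
- by left.
- move=> [dst [hm|[_ hm]]]; first by left; exists dst.
  have [r [vs [hv /(inbox_sent hr) hin hsel]]] := step_cert_ack cs hm.
  right; exists vs; split=> // q vt occ hq sg hs.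
  by exists r, p', (CertReq x v vs); split=> //; exists q, vt, occ.
- move=> [dst [hm|[e _]]]; first by left; exists dst.
  by move: hp; rewrite e hp'.
Qed.

(** * Quorum intersection *)

Context (ht : 1 <= t) (htf : t <= f) (hn : 3 * f + 2 * t - 1 <= n).
Context (hByz : #|Byz| <= f).

Lemma quorum_bounds : n + f + 1 <= 2 * quorum (n := n) f <= n + f + 2.
Proof.
rewrite /quorum uphalf_half; have := odd_double_half (n + f + 1).
by case: odd => /=; lia.
Qed.

Lemma card_set_ord (A : {set 'I_n}) : #|A| <= n.
Proof. by rewrite -[X in _ <= X]card_ord max_card. Qed.

Lemma inter_correct (A B : {set 'I_n}) :
  n + f < #|A| + #|B| -> exists q, [/\ q \in A, q \in B & q \notin Byz].
Proof.
move=> h; have hAB := cardsUI A B; have hU := card_set_ord (A :|: B).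
have : 0 < #|(A :&: B) :\: Byz|.
  have := cardsID Byz (A :&: B).
  have := subset_leq_card (subsetIr (A :&: B) Byz); lia.
by case/card_gt0P => q; rewrite !inE => /and3P[? ? ?]; exists q.
Qed.

Lemma quorum_acked_inj s x y v :
  reach s -> quorum_acked s x v -> quorum_acked s y v -> x = y.
Proof.
move=> hr [A [hA ackA]] [B [hB ackB]].
have [q [qA qB hq]] : exists q, [/\ q \in A, q \in B & q \notin Byz].
  by apply: inter_correct; have := quorum_bounds; lia.
exact: run_ack_inj (reachable_run hq hr) (ackA q qA hq) (ackB q qB hq).
Qed.

Lemma fast_quorum_acked s x v : fast_decision s x v -> quorum_acked s x v.
Proof.
move=> [A [hA ackA]]; exists A; split=> //.
(* Since [f >= 1], [n >= f + 2t + 1], so [2(n - t) >= n + f + 1]. *)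
by have := quorum_bounds; lia.
Qed.

Lemma cc_quorum_acked s cc x v :
  reach s -> valid_commit_cert f cc x v ->
  (forall sg, signed_in_cc cc sg -> issued s sg) -> quorum_acked s x v.
Proof.
move=> hr [<- <- hc] hs; exists (cc_signers cc); split; first by rewrite hc.
move=> q qc hq.
apply: (issued_own (sg := (q, SAck (cc_value cc) (cc_view cc)))) => //.
by apply: hs; exists q.
Qed.

Lemma quorum_correct (A : {set 'I_n}) :
  quorum (n := n) f <= #|A| -> exists2 q, q \in A & q \notin Byz.
Proof.
move=> hA; have [|q [? _ ?]] := @inter_correct A setT; last by exists q.
by rewrite cardsT card_ord; have := quorum_bounds; lia.
Qed.

Lemma slow_quorum_acked s x v :
  reach s -> slow_decision s x v -> quorum_acked s x v.
Proof.
move=> hr [A [/quorum_correct [q qA hq] comA]].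
have [cc hlog hcc] := comA q qA hq.
by apply: (cc_quorum_acked hr hcc) => sg; apply: log_issued hlog.
Qed.

Lemma decision_quorum_acked s x v :
  reach s -> decision s x v -> quorum_acked s x v.
Proof. by move=> hr [/fast_quorum_acked|/(slow_quorum_acked hr)]. Qed.

(** * Selection from the votes collected after a decision *)

Section Ballot.
Variables (s : global_state Value n) (vs : ballot Value n) (w : nat).
Hypothesis (hr : reach s) (hvs : issued_ballot s vs w).

Lemma voter_log q vt occ :
  q \notin Byz -> vs q = Some (vt, occ) -> log s q (VoteMsg q vt occ w).
Proof.
move=> hq hv; apply: (issued_own (sg := (q, SVote vt occ w))) => //.
by apply: hvs hv _ _; constructor 1.
Qed.

Lemma voter_covers q vt occ x v :
  q \notin Byz -> vs q = Some (vt, occ) -> log s q (Ack x v) -> v < w ->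
  covers vt x v.
Proof.
move=> hq /(voter_log hq) hlog.
by have [_] := run_vote_msg (reachable_run hq hr) hlog; apply.
Qed.

Lemma voter_acked_voted q x v :
  q \notin Byz -> q \in voters vs -> log s q (Ack x v) -> v < w ->
  exists y u, [/\ voted_for vs q y u, v <= u & u = v -> y = x].
Proof.
rewrite inE => hq; case e: (vs q) => [[vt occ]|//] _ hack hvw.
have := voter_covers hq e hack hvw.
case: vt e => [//|y u sigma tau] e [hvu hy].
by exists y, u; split=> //; exists sigma, tau, occ.
Qed.

Lemma quorum_acked_voted x v (A : {set 'I_n}) :
  A \subset voters vs -> n - f <= #|A| -> quorum_acked s x v -> v < w ->
  exists y u, [/\ exists q, voted_for vs q y u, v <= u & u = v -> y = x].
Proof.
move=> /subsetP Asub hA [B [hB ackB]] hvw.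
have [|q [qA qB hq]] := @inter_correct A B.
  (* This needs [|B| > 2f], and [2|B| >= n + f + 1 >= 4f + 2t]. *)
  by have := quorum_bounds; lia.
have [y [u [? ? ?]]] :=
  voter_acked_voted hq (Asub q qA) (ackB q qB hq) hvw.
by exists y, u; split=> //; exists q.
Qed.

(** The two valid votes carry the leader's signatures on two proposals for one view, whereas a
    correct leader signs only one. *)
Lemma equivocator_Byz u :
  enough_valid_votes f vs -> equivocation vs u ->
  exists2 q, q \in Byz & leads q u.
Proof.
move=> [_ hval] [q1 [q2 [x1 [x2 [[sg1 [t1 [o1 e1]]] [sg2 [t2 [o2 e2]]] ne]]]]].
have [_ l1] := hval _ _ _ e1; have [_ l2] := hval _ _ _ e2.
have et : t2 = t1 by apply: val_inj; rewrite /= (eqP l1) (eqP l2).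
exists t1 => //; apply: contra_notT ne => ht1.
have i1 : issued s (t1, SPropose x1 u).
  by apply: hvs e1 _ _; constructor 2; left.
have i2 : issued s (t1, SPropose x2 u).
  by apply: hvs e2 _ _; constructor 2; left; rewrite et.
have [sigma1 h1] := issued_own hr (sg := (t1, SPropose x1 u)) ht1 i1.
have [sigma2 h2] := issued_own hr (sg := (t1, SPropose x2 u)) ht1 i2.
exact: run_propose_inj (reachable_run ht1 hr) h1 h2.
Qed.

Lemma cc_rule_acked u (S : {set 'I_n}) x :
  cc_rule f vs u S x -> quorum_acked s x u.
Proof.
move=> [q _ [vt [cc [e hcc]]]]; apply: (cc_quorum_acked hr hcc) => sg hs.
by apply: hvs e _ _; constructor 3; exists cc.
Qed.

(* The equivocating leader is Byzantine and does not vote in S, which leaves at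
   most f - 1 Byzantine voters. *)
Lemma votes'_correct u (S : {set 'I_n}) (A : {set 'I_n}) :
  (exists2 q, q \in Byz & leads q u) -> votes' f vs u S ->
  #|A| <= #|(S :&: A) :\: Byz| + 2 * f - 1.
Proof.
move=> [b bB lb] [_ hS nl].
have hbS : b \notin S by apply/negP => /nl; rewrite lb.
have : #|S :&: Byz| <= f.-1.
  have : S :&: Byz \subset Byz :\ b.
    apply/subsetP => q; rewrite !inE => /andP[qS ->]; rewrite andbT.
    by apply: contra hbS => /eqP <-.
  move/subset_leq_card => le; have := hByz.
  by rewrite (cardsD1 b) bB add1n; lia.
(* [S] misses [f] processes, so [|A| <= |S :&: A| + f], and at most [f - 1] of the intersection is
   Byzantine. *)
have := cardsID Byz (S :&: A).
have := subset_leq_card (subsetIl (S :&: Byz) A).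
rewrite setIAC.
have := cardsUI S A; have := card_set_ord (S :|: A).
lia.
Qed.

(** The hypothesis on votes for views above [v] is what the induction in [decision_locks]
    supplies. *)
Lemma selects_decision x y v :
  decision s x v -> v < w ->
  (forall q z u, voted_for vs q z u -> v < u -> z = x) ->
  selects f t vs (fun _ => True) y -> y = x.
Proof.
move=> hdec hvw hlater.
have hacked := decision_quorum_acked hr hdec.
have high : forall w', enough_valid_votes f vs -> highest_view vs w' ->
    v <= w' /\ exists q, voted_for vs q x w'.
  move=> w' [hq _] [[q [z hz]] hmax].
  have [z' [u [[q' hz'] hvu hu]]] :=
    quorum_acked_voted (subxx _) hq hacked hvw.
  have huw := hmax _ _ _ hz'; split; first exact: leq_trans huw.
  have [ltvw'|le] := ltnP v w'.
    by exists q; rewrite -(hlater _ _ _ hz ltvw').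
  have eu : u = w' by lia.
  by exists q'; rewrite -eu -hu //; lia.
(* Above [v] all votes are for [x], so two values can only meet in view [v]. *)
have highE : forall w', enough_valid_votes f vs -> highest_view vs w' ->
    equivocation vs w' -> w' = v.
  move=> w' hq hw' [q1 [q2 [x1 [x2 [h1 h2 ne]]]]].
  have [hv _] := high w' hq hw'; apply/eqP; rewrite eqn_leq hv andbT leqNgt.
  apply/negP => lt; apply: ne.
  by rewrite (hlater _ _ _ h1 lt) (hlater _ _ _ h2 lt).
have hcc S z : cc_rule f vs v S z -> z = x.
  by move/cc_rule_acked => hz; apply: quorum_acked_inj hr hz hacked.
have hvote q : highest_view vs v -> q \in voters vs -> q \notin Byz ->
    log s q (Ack x v) -> voted_for vs q x v.
  move=> [_ hmax] qv hq hack.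
  have [z [u [hz hvu hzx]]] := voter_acked_voted hq qv hack hvw.
  have eu : u = v by have := hmax _ _ _ hz; lia.
  by rewrite -eu -hzx.
(* This excludes the free choice and leaves [x] as the only outcome of counting. *)
have hrule w' S : enough_valid_votes f vs -> highest_view vs w' ->
    equivocation vs w' -> votes' f vs w' S ->
    w' = v /\ ((exists z, cc_rule f vs w' S z) \/
      count_rule f t vs w' S x /\ forall z, count_rule f t vs w' S z -> z = x).
  move=> hq hw' heq hS; have ew := highE w' hq hw' heq; subst w'; split=> //.
  have hB := equivocator_Byz hq heq; have [/subsetP Ssub cS _] := hS.
  case: hdec => [[A [hA ackA]]|[A [hA comA]]].
    right; set T := (S :&: A) :\: Byz.
    (* Hence [|T| >= n - t - 2f + 1 >= f + t], exactly the threshold of [count_rule]. *)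
    have hT : n - t <= #|T| + 2 * f - 1.
      exact: leq_trans hA (votes'_correct A hB hS).
    have voteT q : q \in T -> voted_for vs q x v.
      rewrite !inE => /and3P[hqB qS qA].
      by apply: hvote => //; [apply: Ssub|apply: ackA].
    have TS : T \subset S.
      by apply/subsetP => q; rewrite !inE => /and3P[].
    split; first by exists T; split=> //; lia.
    move=> z [T' [T'S hT' voteT']].
    have [|] := boolP [disjoint T & T']; last first.
      case/pred0Pn => q /andP[/= /voteT [? [? [? e]]] /voteT' [? [? [? e']]]].
      by move: e; rewrite e' => -[].
    (* Disjoint [T] and [T'] would have at least [(n - t - 2f + 1) + (f + t) = n - f + 1] elements
       in [S], which has [n - f]. *)
    rewrite -leq_card_setU => /eqP hTT'.
    have : #|T :|: T'| <= #|S| by apply: subset_leq_card; rewrite subUset TS.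
    lia.
  left.
  have : 0 < #|(S :&: A) :\: Byz|.
    have := votes'_correct A hB hS.
    by have := quorum_bounds; lia.
  case/card_gt0P => q; rewrite !inE => /and3P[hqB qS qA].
  have [cc hcom _] := comA q qA hqB.
  have := Ssub q qS; rewrite inE; case e: (vs q) => [[vt occ]|//] _.
  have hlog := voter_log hqB e; have hrun := reachable_run hqB hr.
  have [cc' eo hvc] := run_vote_msg_commit hrun hlog hcom hvw.
  rewrite eo in e hlog; have [hcw hcs] := run_vote_msg_cert hrun hlog.
  have hval : valid_commit_cert f cc' (cc_value cc') (cc_view cc') by [].
  have hack' : quorum_acked s (cc_value cc') (cc_view cc').
    apply: (cc_quorum_acked hr hval) => sg hs.
    by apply: hvs e _ _; constructor 3; exists cc'.
  (* A certificate for a later view would entail votes for a later view. *)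
  have [z [u [[q' hz] hu _]]] :=
    quorum_acked_voted (subxx _) (proj1 hq) hack' hcw.
  have := proj2 hw' _ _ _ hz => huv.
  have ev : cc_view cc' = v by lia.
  by exists (cc_value cc'), q => //; exists vt, cc'.
case.
- move=> hq hno _; exfalso.
  have [z [u [[q [sg [tau [occ /hno //]]]] _ _]]] :=
    quorum_acked_voted (subxx _) (proj1 hq) hacked hvw.
- by move=> w' hq hw' huniq; have [_ [q /huniq]] := high w' hq hw'.
- move=> w' S hq hw' heq hS; rewrite (highE w' hq hw' heq); exact: hcc.
- move=> w' S hq hw' heq hS nocc hcount.
  have [_ [[z /nocc //]|[_]]] := hrule w' S hq hw' heq hS; exact.
- move=> w' S hq hw' heq hS nocc nocount _.
  by have [_ [[z /nocc //]|[/nocount]]] := hrule w' S hq hw' heq hS.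
Qed.

End Ballot.

(** * Locking by induction along the execution, and agreement *)

Lemma selects_valid vs own y :
  selects f t vs own y -> enough_valid_votes f vs.
Proof. by case. Qed.

Lemma progress_cert_ack s x u (Q : {set 'I_n}) :
  reach s -> #|Q| = f.+1 ->
  (forall q, q \in Q -> issued s (q, SCertAck x u)) ->
  exists2 q, q \notin Byz & log s q (CertAck x u q).
Proof.
move=> hr cQ hQ.
have : ~~ (Q \subset Byz) by apply/negP => /subset_leq_card; lia.
case/subsetPn => q qQ hq; exists q => //.
exact: (issued_own hr (sg := (q, SCertAck x u)) hq (hQ q qQ)).
Qed.

Lemma valid_progress_cert_gt0 v sigma :
  valid_progress_cert (n := n) f v sigma -> 0 < v.
Proof. by case: sigma => [Q [/ltnW]|/= ->]. Qed.

(** Some member of the quorum is correct and acknowledged only after receiving a valid proposal with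
    its certificate. *)
Lemma quorum_acked_proposal s x v :
  reach s -> quorum_acked s x v ->
  exists sigma, valid_progress_cert f v sigma /\
    forall Q q, sigma = Some Q -> q \in Q -> issued s (q, SCertAck x v).
Proof.
move=> hr [A [/quorum_correct [q qA hq] ackA]].
have [sigma [tau [[hval _] hs]]] :=
  run_ack_sig (reachable_run hq hr) (ackA q qA hq).
exists sigma; split=> // Q r e rQ; apply: has_sig_issued hr _.
by apply: hs; right; rewrite e; exists r.
Qed.

(* Votes may refer to views above the one in which they are collected, so the
   induction is on the prefixes of the execution that leads to s, not on
   views. *)
Lemma decision_locks s x v s' p y u :
  reach s -> decision s x v ->
  reach s' -> incl_sent s' s -> p \notin Byz -> v < u ->
  log s' p (CertAck y u p) -> y = x.
Proof.
move=> hr hdec hr'.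
have hacked := decision_quorum_acked hr hdec.
have v_gt0 : 0 < v.
  have [sigma [hval _]] := quorum_acked_proposal hr hacked.
  exact: valid_progress_cert_gt0 hval.
elim: hr' p y u => {s'} [|s1 s2 hr1 IH st] p y u hsub hp hvu.
  by move=> [dst []].
have hsub1 : incl_sent s1 s.
  by move=> src dst m hm; apply/hsub/(step_incl st).
move=> /(log_cert_ack_step hp hr1 st) [|[vs [_ hvs hsel]]]; first exact: IH.
(* The ballot is analysed in [s], where the decision exists, but its certificates are traced in
   [s1], where the induction hypothesis applies. *)
have hvs' : issued_ballot s vs u.
  by move=> q vt occ e sg hs; apply: (incl_issued hsub1); apply: hvs e _ hs.
have [_ hvalid] := selects_valid hsel.
apply: (selects_decision hr hvs' hdec hvu _ hsel).
move=> q z u' [sigma [tau [occ e]]] hvu'.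
have [/= hval _] := hvalid _ _ _ e.
(* The empty certificate is valid in view 1 only, excluded by [0 < v < u']. *)
case: sigma e hval => [Q|] e; last by move=> /= ?; lia.
move=> [_ cQ]; have [|q' hq'] := progress_cert_ack (x := z) (u := u') hr1 cQ.
  move=> r rQ; apply: hvs e _ _; constructor 2; right.
  by exists r.
exact: IH.
Qed.

Lemma decided_decision s p x :
  reach s -> p \notin Byz -> decided (local s p) x ->
  exists v, decision s x v.
Proof.
move=> hr hp /(run_decided (reachable_run hp hr)) [v hv]; exists v.
case: hv => [[S [hS hin]]|[S [hS hin]]]; [left|right]; exists S; split=> // q.
  by move=> /hin /(inbox_sent hr) ? _; exists p.
by move=> /hin [cc /(inbox_sent hr) ? ?] _; exists cc => //; exists p.
Qed.

(** If [v < w], the acknowledgments of [y] rest on a progress certificate with a correct signer, who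
    is locked on [x]. *)
Lemma decision_quorum_acked_inj s x y v w :
  reach s -> decision s x v ->
  quorum_acked s y w -> v <= w -> x = y.
Proof.
move=> hr hx hy; have hx' := decision_quorum_acked hr hx.
rewrite leq_eqVlt => /orP[/eqP evw|hvw].
  by apply: quorum_acked_inj hr hx' _; rewrite evw.
have [sigma [hval hsig]] := quorum_acked_proposal hr hy.
have [sigma0 [hval0 _]] := quorum_acked_proposal hr hx'.
have v_gt0 := valid_progress_cert_gt0 hval0.
case: sigma hval hsig => [Q [_ cQ] hsig|/= ? _]; last by lia.
have [q hq hlog] := progress_cert_ack hr cQ (fun q => hsig Q q erefl).
by rewrite (decision_locks hr hx hr _ hq hvw hlog).
Qed.

End Executions.

Theorem theoremA4 (Value : Type) (n f t : nat)
    (ht : 1 <= t) (htf : t <= f) (hn : 3 * f + 2 * t - 1 <= n)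
    (Byz : {set 'I_n}) (hByz : #|Byz| <= f) (input : 'I_n -> Value)
    (s : global_state Value n) (hs : reachable f t Byz input s)
    (p q : 'I_n) (hp : p \notin Byz) (hq : q \notin Byz) (x y : Value)
    (hx : decided (local s p) x) (hy : decided (local s q) y) :
  x = y.
Proof.
have [v dv] := decided_decision hs hp hx.
have [w dw] := decided_decision hs hq hy.
have acked z u : decision f t Byz s z u -> quorum_acked f Byz s z u.
  exact: decision_quorum_acked hs.
have [le|/ltnW le] := leqP v w.
  exact: decision_quorum_acked_inj hs dv (acked _ _ dw) le.
by apply/esym; apply: decision_quorum_acked_inj hs dw (acked _ _ dv) le.
Qed.
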